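(* Let $I$ be a finite set, let $a,b \in \mathbb{R}$, let $f : [a,b]^I \to \mathbb{R}$ be a function that is permutation invariant in its $\#I$ variables and affine-linear in each of these variables, let $r \in \mathbb{N}_0$, and let $c = (c_1,\ldots,c_r) \in \mathbb{R}^r$ be such that $$D := \big\{ x \in [a,b]^I : S_\ell(x) = c_\ell \text{ for all } \ell \in \{1,\ldots,r\} \big\} \neq \emptyset .$$ Then $\max_{x \in D} f(x)$ (exists and) is attained at some $x \in D$ with $$\#\big(\{x_i : i \in I\} \setminus \{a,b\}\big) \le r .$$
   Context: $\mathbb{N}_0=\{0,1,2,\ldots\}$; $\#A$ is the number of elements of a set $A$. In particular $\{x_i : i\in I\}$ is a set, so $\#(\{x_i : i\in I\}\setminus\{a,b\})$ counts distinct values. For a finite set $I$, $x=(x_i)_{i\in I} \in \mathbb{R}^I$ and an integer $\ell\ge 1$, the $\ell$-th power sum is $S_\ell(x) := \sum_{i \in I} x_i^\ell$. For $r=0$ there are no constraints, so $D=[a,b]^I$. Permutation invariant means $f\big((x_{\pi(i)})_{i\in I}\big)=f\big((x_i)_{i\in I}\big)$ for every bijection $\pi:I\to I$ and every $x\in[a,b]^I$. Affine-linear in each variable means that for each $i \in I$, with all other coordinates fixed arbitrarily, $f$ is a function of the form $x_i \mapsto \alpha + \beta x_i$ on $[a,b]$. *)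

(* Defs.v *)
From mathcomp Require Import all_boot all_order all_algebra perm finmap.
From mathcomp Require Import boolp classical_sets reals.

Set Implicit Arguments.
Unset Strict Implicit.
Unset Printing Implicit Defensive.

Import Order.TTheory GRing.Theory Num.Theory.

Local Open Scope classical_set_scope.
Local Open Scope ring_scope.

(* A function on the cube [a, b]^I is represented by a total function on
   {ffun I -> R} of which only the values on [cube I a b] are ever used. *)

Definition cube (R : realType) (I : finType) (a b : R) : set {ffun I -> R} :=
  [set x | forall i, a <= x i <= b].

Definition power_sum (R : realType) (I : finType) (l : nat)
    (x : {ffun I -> R}) : R :=
  \sum_(i : I) x i ^+ l.

Definition perm_invariant (R : realType) (I : finType) (a b : R)
    (f : {ffun I -> R} -> R) : Prop :=
  forall (p : {perm I}) (x : {ffun I -> R}), cube a b x ->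
    f [ffun i => x (p i)] = f x.

Definition update (R : realType) (I : finType) (x : {ffun I -> R}) (i : I)
    (t : R) : {ffun I -> R} :=
  [ffun j => if j == i then t else x j].

Definition multiaffine (R : realType) (I : finType) (a b : R)
    (f : {ffun I -> R} -> R) : Prop :=
  forall (i : I) (x : {ffun I -> R}), cube a b x ->
    exists alpha beta : R, forall t : R, a <= t <= b ->
      f (update x i t) = alpha + beta * t.

(* The ordinal l : 'I_r stands for the index l + 1 in {1, ..., r}, so that
   [c l] is c_(l+1). *)
Definition feasible (R : realType) (I : finType) (a b : R) (r : nat)
    (c : 'I_r -> R) : set {ffun I -> R} :=
  [set x | cube a b x /\ forall l : 'I_r, power_sum l.+1 x = c l].

(* Main.v *)
Require Import Defs.
From mathcomp Require Import all_boot all_order all_algebra finmap.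
From mathcomp Require Import boolp classical_sets reals.
From mathcomp Require Import perm ring lra.
From mathcomp Require Import topology normedtype derive realfun.

Set Implicit Arguments.
Unset Strict Implicit.
Unset Printing Implicit Defensive.

Import Order.TTheory GRing.Theory Num.Theory.
Import numFieldNormedType.Exports.

Local Open Scope classical_set_scope.
Local Open Scope ring_scope.

(** Assume a < b; otherwise the cube has at most one point. Write n = #|I|, and
    attach to a point x the polynomial P_x = \prod_i ('X - x_i).

    A symmetric multiaffine f is, on the cube, a fixed linear functional of the
    coefficients of P_x ([symmetric_multiaffine_coef_comb]): both sides are
    multiaffine, so it suffices to compare them at the vertices of the cube.
    There f depends only on the number k of coordinates equal to b, and
    P_x = ('X - b)^k ('X - a)^(n - k); these n + 1 polynomials are linearly
    independent, so some functional takes the prescribed values on them.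

    Take a feasible x that maximizes f and, among the maximizers, maximizes the
    coefficient of degree n - r - 1 of P_x; it exists by compactness
    ([exists_feasible_lex_max]). Suppose that more than r distinct values of x
    lie in ]a, b[, and let J be a set of r + 1 indices at which x takes
    distinct such values. The factor p of P_x over J has simple roots in
    ]a, b[, so p + e also splits with roots in [a, b] whenever e is small
    enough, whatever its sign ([perturbed_roots]). Replacing the coordinates
    in J by these roots keeps the power sums up to order r, because they do not
    involve the constant coefficient of p ([power_sum_shift]). It adds e * K to
    P_x, where K is the monic factor of P_x of degree n - r - 1 over the
    complement of J ([feasible_shift]). Hence f changes by e * L(K) for its
    functional L; as both signs of e are allowed, maximality forces L(K) = 0.
    Then f is unchanged, while for e > 0 the coefficient of degree n - r - 1
    grows by e: a contradiction. *)

(** * Linear functionals of the coefficients *)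

Definition coef_comb (R : nzRingType) (lam : nat -> R) (n : nat)
    (p : {poly R}) : R := \sum_(j < n.+1) lam j * p`_j.

Lemma coef_combD (R : nzRingType) (lam : nat -> R) n p q :
  coef_comb lam n (p + q) = coef_comb lam n p + coef_comb lam n q.
Proof.
by rewrite -big_split; apply: eq_bigr => j _; rewrite coefD mulrDr.
Qed.

Lemma coef_combZ (R : comNzRingType) (lam : nat -> R) n c p :
  coef_comb lam n (c *: p) = c * coef_comb lam n p.
Proof.
by rewrite /coef_comb mulr_sumr; apply: eq_bigr => j _; rewrite coefZ mulrCA.
Qed.

(** The polynomials ('X - b)^k ('X - a)^(n - k), the Bernstein basis of the
    segment up to scalars, are linearly independent: a linear functional on
    polynomials of degree at most n can take any prescribed values on them. *)
Lemma exists_coef_comb_bernstein (F : fieldType) (a b : F) (n : nat)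
    (w : nat -> F) : a != b ->
  exists lam, forall k, (k <= n)%N ->
    coef_comb lam n (('X - b%:P) ^+ k * ('X - a%:P) ^+ (n - k)) = w k.
Proof.
move=> neq_ab; elim: n w => [|n IHn] w.
  exists w => k; rewrite leqn0 => /eqP ->.
  by rewrite /coef_comb big_ord1 !expr0 mulr1 coef1 mulr1.
pose G m k : {poly F} := ('X - b%:P) ^+ k * ('X - a%:P) ^+ (m - k).
(* Since G n.+1 k - G n.+1 k.+1 = (b - a) G n k, the differences of the target
   values are imposed in degree n; the new coefficient then fits the value at
   k = 0. *)
have [lam lamE] := IHn (fun k => (w k - w k.+1) / (b - a)).
pose lam' j := if j == n.+1 then w 0 - coef_comb lam n (G n.+1 0) else lam j.
have lam'E p : coef_comb lam' n.+1 p = coef_comb lam n p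
    + (w 0 - coef_comb lam n (G n.+1 0)) * p`_n.+1.
  rewrite /coef_comb big_ord_recr /= /lam' eqxx; congr (_ + _).
  by apply: eq_bigr => j _; rewrite ltn_eqF.
have sizeG m k : (k <= m)%N -> size (G m k) = m.+1.
  move=> le_km; rewrite size_monicM ?monic_exp ?monicXsubC //; last first.
    by rewrite expf_neq0 // polyXsubC_eq0.
  by rewrite !size_exp_XsubC addnS addSn /= subnKC.
exists lam'; rewrite -/(G n.+1 _); elim=> [_|k IHk lt_kn].
  have -> : ('X - b%:P) ^+ 0 * ('X - a%:P) ^+ (n.+1 - 0) = G n.+1 0 by [].
  rewrite lam'E.
  have -> : (G n.+1 0)`_n.+1 = 1.
    have : G n.+1 0 \is monic by rewrite monicMl ?monic_exp ?monicXsubC.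
    by move/monicP; rewrite lead_coefE sizeG.
  by rewrite mulr1 addrC subrK.
have -> : ('X - b%:P) ^+ k.+1 * ('X - a%:P) ^+ (n.+1 - k.+1)
    = G n.+1 k + (a - b) *: G n k.
  rewrite /G subSS subSn // -mul_polyC !exprS polyCB; ring.
rewrite coef_combD IHk ?(ltnW lt_kn) // coef_combZ lam'E lamE //.
rewrite (_ : (G n k)`_n.+1 = 0); last by rewrite nth_default // sizeG.
by field; rewrite subr_eq0 eq_sym.
Qed.

(** * Symmetric multiaffine functions *)

Definition root_poly (R : nzRingType) (I : finType) (x : I -> R) : {poly R} :=
  \prod_i ('X - (x i)%:P).

Definition vertex (R : realType) (I : finType) (a b : R) (A : {set I}) :
  {ffun I -> R} := [ffun i => if i \in A then b else a].

(** An affine function of one variable is determined by its values at a and at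
    b, so coordinates can be moved to the ends of the segment one at a time: the
    induction is on the number of coordinates outside {a, b}. *)
Lemma multiaffine_eq (R : realType) (I : finType) (a b : R)
    (f g : {ffun I -> R} -> R) :
  a < b -> multiaffine a b f -> multiaffine a b g ->
  (forall A, f (vertex a b A) = g (vertex a b A)) ->
  forall x, cube a b x -> f x = g x.
Proof.
move=> lt_ab f_aff g_aff fgV x.
have [m] := ubnP #|[set i | (x i != a) && (x i != b)]%SET|.
elim: m x => // m IHm x lem cx.
have [x0|/set0Pn[i]] := eqVneq [set i | (x i != a) && (x i != b)]%SET finset.set0.
  have -> : x = vertex a b [set i | x i == b]%SET; last exact: fgV.
  apply/ffunP => i; rewrite ffunE inE; case: eqP => // /eqP xib.
  apply/eqP/negPn/negP => xia.
  by move/setP/(_ i): x0; rewrite !inE xia xib.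
rewrite inE => xi.
have agree t : (t == a) || (t == b) -> f (update x i t) = g (update x i t).
  move=> tab; apply: IHm => [|j]; last first.
    rewrite ffunE; case: eqP => // _.
    by case/orP: tab => /eqP ->; rewrite lexx ltW.
  rewrite ltnS in lem; apply: leq_trans lem; apply/proper_card/properP; split.
    apply/fintype.subsetP => j; rewrite !inE ffunE; have [_|//] := eqVneq j i.
    by rewrite -negb_or tab.
  by exists i; rewrite ?inE // ffunE eqxx -negb_or tab.
have [fa [fb fE]] := f_aff i x cx; have [ga [gb gE]] := g_aff i x cx.
have := agree b; have := agree a.
rewrite !eqxx orbT !fE ?gE ?lexx ?ltW // => /(_ isT) eqa /(_ isT) eqb.
have -> : x = update x i (x i).
  by apply/ffunP => j; rewrite ffunE; case: eqP => // ->.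
rewrite fE // gE //.
have : (fb - gb) * (b - a) = 0 by lra.
move/eqP; rewrite mulf_eq0 [b - a == 0]subr_eq0 (gt_eqF lt_ab) orbF subr_eq0.
by move=> /eqP eqfb; rewrite eqfb in eqa *; lra.
Qed.

Lemma exists_perm_card (I : finType) (A B : {set I}) : #|A| = #|B| ->
  exists p : {perm I}, forall i, (p i \in B) = (i \in A).
Proof.
move=> cAB.
(* List I with the elements of A (resp. B) first, and match the two lists
   position by position. *)
pose e (C : {set I}) := enum C ++ enum (~: C)%SET.
have eu C : uniq (e C).
  rewrite cat_uniq !enum_uniq andbT; apply/hasPn => i.
  by rewrite !mem_enum inE.
have ei C i : i \in e C by rewrite mem_cat !mem_enum inE orbN.
have se C : size (e C) = #|I| by rewrite size_cat -!cardE cardsC.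
pose p i := nth i (e B) (index i (e A)).
have lt_i i : (index i (e A) < size (e B))%N by rewrite se -(se A) index_mem.
have p_inj : injective p.
  move=> i j; rewrite /p (set_nth_default i) // => /eqP.
  rewrite nth_uniq // => /eqP eq_ij.
  by have := congr1 (nth i (e A)) eq_ij;
    rewrite (nth_index i (ei A i)) (nth_index i (ei A j)).
exists (perm p_inj) => i; rewrite permE /p nth_cat -cardE -cAB index_cat mem_enum.
case: (boolP (i \in A)) => iA.
  have ltA : (index i (enum A) < #|A|)%N by rewrite cardE index_mem mem_enum.
  by rewrite ltA -mem_enum mem_nth // -cardE -cAB.
rewrite -cardE ltnNge leq_addr /= addKn.
have : nth i (enum (~: B)%SET) (index i (enum (~: A)%SET)) \in enum (~: B)%SET.
  have cCAB : #|~: A| = #|~: B|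
    by rewrite [LHS]cardsCs [RHS]cardsCs !finset.setCK cAB.
  rewrite mem_nth // -cardE -cCAB.
  by rewrite cardE index_mem mem_enum inE.
by rewrite mem_enum inE => /negbTE.
Qed.

(** This reduces the problem to polynomials: any move that changes [root_poly]
    by a multiple of a fixed polynomial changes f affinely. Both sides are
    multiaffine, hence only vertices matter; symmetry makes the value of f at a
    vertex depend only on the number of coordinates equal to b. *)
Lemma symmetric_multiaffine_coef_comb (R : realType) (I : finType) (a b : R)
    (f : {ffun I -> R} -> R) :
  a < b -> perm_invariant a b f -> multiaffine a b f ->
  exists lam : nat -> R, forall x, cube a b x ->
    f x = coef_comb lam #|I| (root_poly x).
Proof.
move=> lt_ab f_sym f_aff.
have cubeV A : cube a b (vertex a b A : {ffun I -> R}).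
  by move=> i; rewrite ffunE; case: ifP; rewrite lexx ltW.
have fV (A B : {set I}) : #|A| = #|B| -> f (vertex a b A) = f (vertex a b B).
  move=> /exists_perm_card[p pE]; rewrite -(f_sym p _ (cubeV B)).
  by congr f; apply/ffunP => i; rewrite !ffunE pE.
pose w k := f (vertex a b [set i in take k (enum I)]).
have [lam lamE] := exists_coef_comb_bernstein #|I| w (negbT (lt_eqF lt_ab)).
exists lam; apply: (multiaffine_eq lt_ab) => // [i x cx|A].
  pose K := \prod_(j | j != i) ('X - (x j)%:P).
  exists (coef_comb lam #|I| ('X * K)), (- coef_comb lam #|I| K) => t _.
  rewrite /root_poly (bigD1 i) //= ffunE eqxx.
  rewrite (eq_bigr (fun j => 'X - (x j)%:P)) => [|j /negbTE ji]; last first.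
    by rewrite ffunE ji.
  rewrite mulrBl mul_polyC -scaleNr coef_combD coef_combZ -/K.
  by rewrite !mulNr [t * _]mulrC.
have leA : (#|A| <= #|I|)%N by rewrite max_card.
rewrite (fV A [set i in take #|A| (enum I)]); last first.
  rewrite cardsE (card_uniqP _) ?take_uniq ?enum_uniq //.
  by rewrite size_take_min -cardE; apply/esym/minn_idPl.
rewrite -/(w #|A|) -lamE //; congr coef_comb.
rewrite /root_poly (bigID (mem A)) /=; congr (_ * _).
  rewrite (eq_bigr (fun=> 'X - b%:P)) ?prodr_const // => i iA.
  by rewrite ffunE iA.
rewrite (eq_bigr (fun=> 'X - a%:P)) => [|i /negbTE iA]; last first.
  by rewrite ffunE iA.
rewrite -[(#|I| - _)%N](_ : #|(~: A)%SET| = _); last first.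
  by rewrite (cardsCs (~: A)%SET) finset.setCK.
by rewrite -prodr_const; apply: eq_bigl => i; rewrite inE.
Qed.

(** * Power sums of the roots *)

(** Summing z^l p / ('X - z) over the roots z of p gives the remainder B of
    'X^l p' modulo p, whose leading term carries the power sum; this
    identifies power sums by division, in place of Newton's identities. *)
Lemma power_sum_remainder (R : comNzRingType) (s : seq R) (l : nat) :
  let p := \prod_(z <- s) ('X - z%:P) in
  exists A B : {poly R}, [/\ 'X^l * p^`() = p * A + B,
    (size A <= l)%N, (size B <= size s)%N
    & B`_(size s).-1 = \sum_(z <- s) z ^+ l].
Proof.
elim: s => [|x s [A [B [eqAB szA szB cB]]]] /=.
  exists 0, 0; rewrite !big_nil size_poly0 coef0 derivC mulr0 mul1r addr0.
  by split.
set p := \prod_(z <- s) _ in eqAB *.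
pose C : {poly R} := \sum_(i < l) 'X^(l.-1 - i) * x%:P ^+ i.
have szp : size p = (size s).+1 by rewrite size_prod_XsubC.
exists (A + C), ((x ^+ l)%:P * p + ('X - x%:P) * B); rewrite !big_cons; split.
- (* 'X^l = x^l + ('X - x) C *)
  rewrite derivM derivXsubC mul1r mulrDr [_ * (_ * p^`())]mulrCA eqAB.
  have := subrXX ('X : {poly R}) x%:P l; rewrite -/C => eqC.
  have -> : 'X^l = x%:P ^+ l + ('X - x%:P) * C by rewrite -eqC addrC subrK.
  rewrite -/p rmorphXn /=; ring.
- apply: leq_trans (size_polyD _ _) _; rewrite geq_max szA /=.
  apply: (leq_trans (size_sum _ _ _)); apply/bigmax_leqP => i _.
  rewrite -rmorphXn mulrC mul_polyC (leq_trans (size_scale_leq _ _)) //.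
  rewrite size_polyXn; case: l i {szA cB eqAB C} => [[]|l i] //=.
  by rewrite ltnS leq_subr.
- apply: leq_trans (size_polyD _ _) _; rewrite geq_max mul_polyC.
  rewrite (leq_trans (size_scale_leq _ _)) ?szp //=.
  have [->|B0] := eqVneq B 0; first by rewrite mulr0 size_poly0.
  by rewrite size_monicM ?monicXsubC // size_XsubC.
- rewrite /= -cB coefD mul_polyC coefZ; congr (_ + _).
    have : p \is monic by apply: monic_prod_XsubC.
    by move/monicP; rewrite lead_coefE szp /= => ->; rewrite mulr1.
  rewrite mulrBl coefB coefXM mul_polyC coefZ [B`_(size s)]nth_default //.
  rewrite mulr0 subr0; case: eqP szB => // ->.
  by rewrite leqn0 size_poly_eq0 => /eqP ->; rewrite coef0.
Qed.

(** Adding a constant e to p does not change p', so the divisions of 'X^l p'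
    by p and by p + e have the same quotient A; the remainders differ by e A,
    too low a degree to affect the coefficient that is the power sum. *)
Lemma power_sum_shift (R : idomainType) (s t : seq R) (e : R) (l : nat) :
  \prod_(z <- t) ('X - z%:P) = \prod_(z <- s) ('X - z%:P) + e%:P ->
  size t = size s -> (l < size s)%N ->
  \sum_(z <- t) z ^+ l = \sum_(z <- s) z ^+ l.
Proof.
move=> eq_ts sz_ts lt_l.
have := power_sum_remainder t l; have := power_sum_remainder s l.
rewrite /= eq_ts derivD derivC addr0 sz_ts.
set p := \prod_(z <- s) _ => -[A [B [eqAB szA szB <-]]].
move=> [A' [B' [eqAB' szA' szB' <-]]].
have szp : size p = (size s).+1 by rewrite size_prod_XsubC.
have p_monic : p \is monic by apply: monic_prod_XsubC.
have eqpA : p * (A - A') = e *: A' + (B' - B).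
  rewrite -mul_polyC; move: eqAB; rewrite eqAB' => /eqP.
  rewrite -subr_eq0 => /eqP eq0.
  by apply/eqP; rewrite -subr_eq0 -oppr0 -eq0; apply/eqP; ring.
(* The right-hand side has degree below that of p, so the cofactor vanishes. *)
have AA' : A = A'.
  apply/eqP; rewrite -subr_eq0; apply/negPn/negP => AA'0.
  have : (size (p * (A - A'))%R <= size s)%N.
    rewrite eqpA (leq_trans (size_polyD _ _)) // geq_max.
    rewrite (leq_trans (size_scale_leq _ _)) ?(leq_trans szA' (ltnW _)) //=.
    by rewrite (leq_trans (size_polyD _ _)) // geq_max size_polyN szB szB'.
  rewrite size_monicM // szp addSn /= leqNgt => /negP; apply.
  by rewrite -addn1 leq_add2l size_poly_gt0.
move: eqpA; rewrite AA' subrr mulr0.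
move=> /(congr1 (fun q : {poly R} => q`_(size s).-1)).
(* A' has degree below l <= size s - 1: e *: A' does not contribute. *)
rewrite coef0 coefD coefZ coefB nth_default ?mulr0 ?add0r; last first.
  by rewrite (leq_trans szA') // -ltnS prednK // (leq_trans _ lt_l).
by move/esym/eqP; rewrite subr_eq0 => /eqP.
Qed.

(** * Perturbation of simple roots *)

Lemma exists_lower_bound (R : realDomainType) (T : eqType) (s : seq T)
    (F : T -> R) :
  (forall i, i \in s -> 0 < F i) ->
  exists2 d, 0 < d & forall i, i \in s -> d <= F i.
Proof.
elim: s => [_|x s IHs Fpos]; first by exists 1.
have [|d d0 dF] := IHs; first by move=> i si; apply: Fpos; rewrite inE si orbT.
exists (Num.min d (F x)) => [|i].
  by rewrite lt_min d0 Fpos // mem_head.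
by rewrite inE ge_min => /predU1P[->|/dF ->//]; rewrite lexx orbT.
Qed.

(** Simple roots persist: the product changes sign across a short segment
    around each root, and still does after a small shift, so the intermediate
    value theorem yields one root per segment, as many as the degree. *)
Lemma perturbed_roots (R : rcfType) (a b : R) (s : seq R) :
  uniq s -> (0 < size s)%N -> (forall z, z \in s -> a < z < b) ->
  exists2 eta, 0 < eta & forall e, `|e| <= eta ->
    exists t : seq R, [/\ size t = size s, (forall z, z \in t -> a <= z <= b)
      & \prod_(z <- t) ('X - z%:P) = \prod_(z <- s) ('X - z%:P) + e%:P].
Proof.
move=> s_uniq s_gt0 s_ab; set p := \prod_(z <- s) _.
have szp : size p = (size s).+1 by rewrite size_prod_XsubC.
have p_monic : p \is monic by apply: monic_prod_XsubC.
(* A radius d such that the segments [z - d, z + d] lie in [a, b] and are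
   pairwise disjoint. *)
have [d1 d1_gt0 d1P] : exists2 d, 0 < d &
    forall z, z \in s -> d <= Num.min (z - a) (b - z).
  by apply: exists_lower_bound => z /s_ab; rewrite lt_min !subr_gt0.
have [d2 d2_gt0 d2P] : exists2 d, 0 < d & forall zw,
    zw \in [seq zw <- [seq (z, w) | z <- s, w <- s] | zw.1 != zw.2] ->
    d <= `|zw.1 - zw.2|.
  apply: exists_lower_bound => zw; rewrite mem_filter => /andP[neq _].
  by rewrite normr_gt0 subr_eq0.
have {}d2P z w : z \in s -> w \in s -> z != w -> d2 <= `|z - w|.
  move=> zs ws zw; apply: (d2P (z, w)); rewrite mem_filter zw /=.
  by apply/allpairsP; exists (z, w).
pose d := Num.min d1 (d2 / 3).
have d_gt0 : 0 < d by rewrite lt_min d1_gt0 divr_gt0.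
have d_le1 : d <= d1 by rewrite ge_min lexx.
have d_le2 : 3 * d <= d2 by rewrite mulrC -ler_pdivlMr // ge_min lexx orbT.
(* Only the factor of z changes sign across the segment around z. *)
have sgn z : z \in s -> p.[z - d] * p.[z + d] < 0.
  move=> zs; rewrite !horner_prod -big_split (big_rem z) //= !hornerXsubC.
  rewrite nmulr_rlt0; last first.
    by rewrite addrAC subrr add0r addrAC subrr add0r mulNr oppr_lt0 mulr_gt0.
  rewrite big_seq; apply: prodr_gt0 => w; rewrite mem_rem_uniq // inE.
  move=> /andP[wz ws].
  rewrite !hornerXsubC [(_ - _) * _](_ : _ = (z - w) ^+ 2 - d ^+ 2); last ring.
  rewrite subr_gt0 -(real_normK (num_real (z - w))) ltrXn2r ?ltW //.
  by have := d2P z w zs ws; rewrite eq_sym wz => /(_ isT) h; lra.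
have [eta eta_gt0 etaP] : exists2 eta, 0 < eta & forall z, z \in s ->
    eta <= Num.min `|p.[z - d]| `|p.[z + d]|.
  apply: exists_lower_bound => z /sgn sz; rewrite lt_min !normr_gt0.
  by apply/andP; split; apply/negP => /eqP z0; rewrite z0 ?mul0r ?mulr0 ltxx in sz.
exists eta => // e e_eta; pose q := p + e%:P.
have szq : size q = (size s).+1.
  rewrite size_polyDl ?szp // ltnS (leq_trans (size_polyC_leq1 _)) //.
have root_q z : z \in s -> exists z', (z - d <= z' <= z + d) && root q z'.
  move=> zs; have le_z : z - d <= z + d by lra.
  have := sgn z zs; have := etaP z zs; rewrite le_min => /andP[etal etar] sz.
  have := e_eta; rewrite ler_norml => /andP[e1 e2].
  have [pl|pl] := ltrP p.[z - d] 0.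
    have pr : 0 < p.[z + d] by rewrite nmulr_rlt0 in sz.
    have [|z' z'in z'root] := @poly_ivt _ q _ _ le_z; last first.
      by exists z'; rewrite z'in.
    rewrite !hornerD !hornerC.
    rewrite ltr0_norm // in etal; rewrite gtr0_norm // in etar; lra.
  have {}pl : 0 < p.[z - d].
    by rewrite lt_def pl andbT; apply/negP => /eqP z0; rewrite z0 mul0r ltxx in sz.
  have pr : p.[z + d] < 0 by rewrite pmulr_rlt0 in sz.
  have [|z' z'in z'root] := @poly_ivt _ (- q) _ _ le_z; last first.
    by exists z'; rewrite z'in -rootN.
  rewrite !hornerN !hornerD !hornerC.
  rewrite gtr0_norm // in etal; rewrite ltr0_norm // in etar; lra.
have [phi phiP] : {phi : R -> R & forall z, z \in s ->
    (z - d <= phi z <= z + d) && root q (phi z)}.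
  apply: (@choice _ _ (fun z z' =>
    z \in s -> (z - d <= z' <= z + d) && root q z')) => z.
  by have [/root_q[z' z'P]|_] := boolP (z \in s); [exists z' | exists 0].
exists [seq phi z | z <- s]; split; first by rewrite size_map.
  move=> _ /mapP[z zs ->]; have /andP[zd _] := phiP z zs.
  by have := d1P z zs; rewrite le_min; lra.
rewrite -/q [q](@all_roots_prod_XsubC _ _ [seq phi z | z <- s]).
- suff -> : lead_coef q = 1 by rewrite scale1r.
  rewrite lead_coefDl ?(monicP p_monic) // szp ltnS.
  by rewrite (leq_trans (size_polyC_leq1 _)).
- by rewrite size_map.
- by apply/allP => _ /mapP[z zs ->]; have /andP[] := phiP z zs.
rewrite uniq_rootsE map_inj_in_uniq // => z w zs ws eq_zw.
have /andP[zd _] := phiP z zs; have /andP[wd _] := phiP w ws.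
apply/eqP/negPn/negP => /(d2P z w zs ws).
by rewrite leNgt => /negP; apply; rewrite ltr_norml; rewrite eq_zw in zd; lra.
Qed.

(** * Lexicographic maximizers *)

(** The maximizers of F on K form a compact set, on which G is maximized in
    turn. *)
Lemma compact_lex_max (R : realType) (T : topologicalType) (K : set T)
    (F G : T -> R) :
  compact K -> K !=set0 -> continuous F -> continuous G ->
  exists2 x, K x & forall y, K y -> F y <= F x /\ (F y = F x -> G y <= G x).
Proof.
move=> Kc K0 Fc Gc.
have [x /set_mem Kx Fx] := compact_EVT_max K0 Kc (continuous_subspaceT Fc).
pose K' := K `&` F @^-1` [set F x].
have K'c : compact K'.
  apply: compact_closedI => //; move/continuous_closedP : Fc; apply.
  exact: closed_eq.
have K'0 : K' !=set0 by exists x.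
have [y /set_mem[Ky Fy] Gy] := compact_EVT_max K'0 K'c (continuous_subspaceT Gc).
exists y => // z Kz; rewrite Fy; split; first exact/Fx/mem_set.
by move=> Fz; apply/Gy/mem_set; split.
Qed.

Lemma continuous_prod_XsubC_coef (R : realType) (T : topologicalType) (J : Type)
    (s : seq J) (u : J -> T -> R) (k : nat) :
  (forall j, continuous (u j)) ->
  continuous (fun x => (\prod_(j <- s) ('X - (u j x)%:P))`_k).
Proof.
move=> uc; elim: s k => [|j s IHs] k.
  under eq_fun do rewrite big_nil; exact: cst_continuous.
under eq_fun do rewrite big_cons mulrBl coefB coefXM mul_polyC coefZ.
move=> x; apply: cvgB; last by apply: cvgM; [exact: uc | exact: IHs].
by case: (k == 0)%N; [exact: cst_continuous | exact: IHs].
Qed.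

Lemma continuous_bigsum (R : realType) (T : topologicalType) (J : Type)
    (s : seq J) (u : J -> T -> R) :
  (forall j, continuous (u j)) -> continuous (fun x => \sum_(j <- s) u j x).
Proof.
move=> uc; elim: s => [|j s IHs].
  under eq_fun do rewrite big_nil; exact: cst_continuous.
under eq_fun do rewrite big_cons.
by move=> x; apply: cvgD; [exact: uc | exact: IHs].
Qed.

Lemma continuous_coef_comb (R : realType) (T : topologicalType)
    (lam : nat -> R) (n : nat) (p : T -> {poly R}) :
  (forall k, continuous (fun x => (p x)`_k)) ->
  continuous (fun x => coef_comb lam n (p x)).
Proof.
move=> pc; apply: continuous_bigsum => j x.
have := @cvgM _ _ _ _ (fun=> lam j) _ _ _ (cvg_cst (lam j)) (pc j x).
exact.
Qed.

(** Compactness is transported to functions with the product topology, where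
    Tychonoff's theorem applies to the cube; power sums are continuous. *)
Lemma feasible_compact (R : realType) (I : finType) (a b : R) (r : nat)
    (c : 'I_r -> R) :
  compact [set x : prod_topology (fun _ : I => R) |
    feasible a b c [ffun i => x i]].
Proof.
pose S (l : 'I_r) (x : prod_topology (fun _ : I => R)) := \sum_i x i ^+ l.+1.
have Sc l : continuous (S l).
  apply: continuous_bigsum => i x.
  apply: (@continuous_comp _ _ _ (fun x : prod_topology (fun _ : I => R) => x i)
    (fun t : R => t ^+ l.+1)); first exact: proj_continuous.
  exact: exprn_continuous.
have -> : [set x : prod_topology (fun _ : I => R) |
      feasible a b c [ffun i => x i]]
  = [set x | forall i : I, `[a, b]%classic (x i)] `&`
    \bigcap_(l in [set: 'I_r]) S l @^-1` [set c l].
  rewrite /feasible /cube /power_sum /=; apply/seteqP; split => x /= [h1 h2]; split.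
  - by move=> i; have := h1 i; rewrite ffunE in_itv.
  - by move=> l _ /=; rewrite -h2; apply: eq_bigr => i _; rewrite ffunE.
  - by move=> i; rewrite ffunE; have := h1 i; rewrite /= in_itv.
  - by move=> l; rewrite -(h2 l Logic.I); apply: eq_bigr => i _; rewrite ffunE.
apply: compact_closedI.
  apply: (@tychonoff I (fun=> R) (fun=> `[a, b]%classic)) => i.
  exact: segment_compact.
apply: closed_bigI => l _; move/continuous_closedP: (Sc l); apply.
exact: closed_eq.
Qed.

Lemma exists_feasible_lex_max (R : realType) (I : finType) (a b : R) (r : nat)
    (c : 'I_r -> R) (lam : nat -> R) (n k : nat) :
  feasible (I := I) a b c !=set0 ->
  exists2 x : {ffun I -> R}, feasible a b c x &
    forall y : {ffun I -> R}, feasible a b c y ->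
      coef_comb lam n (root_poly y) <= coef_comb lam n (root_poly x) /\
      (coef_comb lam n (root_poly y) = coef_comb lam n (root_poly x) ->
       (root_poly y)`_k <= (root_poly x)`_k).
Proof.
have finfunK (x : {ffun I -> R}) : [ffun i => x i] = x.
  by apply/ffunP => i; rewrite ffunE.
move=> [x0 x0D].
have Pc j : continuous (fun u : prod_topology (fun _ : I => R) => (root_poly u)`_j).
  apply: continuous_prod_XsubC_coef => i; exact: proj_continuous.
have Fc := continuous_coef_comb (lam := lam) (n := n) Pc.
have K0 : [set u : prod_topology (fun _ : I => R) |
    feasible a b c [ffun i => u i]] !=set0.
  by exists x0; rewrite /= finfunK.
have [u /= uD umax] := compact_lex_max (@feasible_compact R I a b r c) K0 Fc (Pc k).
exists [ffun i => u i] => // y yD.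
have -> : root_poly [ffun i => u i] = root_poly u.
  by apply: eq_bigr => i _; rewrite ffunE.
by apply: (umax y); rewrite /= finfunK.
Qed.

(** * Moving some coordinates of a feasible point *)

(** Beyond the entries of js the index is out of range, hence the default value
    x i: the coordinates listed in js take the values of t, and the others are
    kept. *)
Definition splice (T : Type) (I : finType) (x : {ffun I -> T}) (js : seq I)
    (t : seq T) : {ffun I -> T} :=
  [ffun i => nth (x i) t (index i js)].

Lemma big_splice (M T : Type) (idx : M) (op : Monoid.com_law idx) (I : finType)
    (x : {ffun I -> T}) (js : seq I) (t : seq T) (F : T -> M) :
  uniq js -> size t = size js ->
  \big[op/idx]_i F (splice x js t i) =
    op (\big[op/idx]_(z <- t) F z) (\big[op/idx]_(i | i \notin js) F (x i)).
Proof.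
move=> js_uniq sz; rewrite (bigID (mem js)) /=; congr (op _ _); last first.
  apply: eq_bigr => i ijs; rewrite ffunE nth_default // sz.
  by rewrite leqNgt index_mem.
rewrite -big_uniq // -(big_map (splice x js t) xpredT F); congr bigop.
case: js js_uniq sz => [|i0 js] js_uniq sz; first by case: t sz.
apply: (@eq_from_nth _ (x i0)); rewrite size_map // => k k_lt.
rewrite (nth_map i0) // ffunE index_uniq //.
by apply: set_nth_default; rewrite sz.
Qed.

Lemma big_splice_self (M T : Type) (idx : M) (op : Monoid.com_law idx)
    (I : finType) (x : {ffun I -> T}) (js : seq I) (F : T -> M) :
  uniq js ->
  \big[op/idx]_i F (x i) =
    op (\big[op/idx]_(z <- map x js) F z) (\big[op/idx]_(i | i \notin js) F (x i)).
Proof.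
by move=> js_uniq; rewrite (bigID (mem js)) /= -big_uniq // big_map.
Qed.

Lemma splice_feasible (R : realType) (I : finType) (a b : R) (r : nat)
    (c : 'I_r -> R) (x : {ffun I -> R}) (js : seq I) (t : seq R) (e : R) :
  feasible a b c x -> uniq js -> (r < size js)%N -> size t = size js ->
  (forall z, z \in t -> a <= z <= b) ->
  \prod_(z <- t) ('X - z%:P) = \prod_(z <- map x js) ('X - z%:P) + e%:P ->
  feasible a b c (splice x js t).
Proof.
move=> [cx Sx] js_uniq lt_r sz t_ab eq_t; split=> [i|l].
  rewrite ffunE; have [ijs|ijs] := boolP (i \in js).
    by apply: t_ab; rewrite mem_nth // sz index_mem.
  by rewrite nth_default ?cx // sz leqNgt index_mem.
rewrite -Sx /power_sum (big_splice _ _ (fun z => z ^+ l.+1)) //.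
rewrite (big_splice_self _ x (fun z => z ^+ l.+1) js_uniq); congr (_ + _).
apply: (power_sum_shift eq_t); first by rewrite size_map.
by rewrite size_map; apply: leq_trans lt_r; rewrite ltnS.
Qed.

Lemma root_poly_splice (R : comNzRingType) (I : finType) (x : {ffun I -> R})
    (js : seq I) (t : seq R) (e : R) :
  uniq js -> size t = size js ->
  \prod_(z <- t) ('X - z%:P) = \prod_(z <- map x js) ('X - z%:P) + e%:P ->
  root_poly (splice x js t) =
    root_poly x + e *: \prod_(i | i \notin js) ('X - (x i)%:P).
Proof.
move=> js_uniq sz eq_t; rewrite /root_poly (big_splice _ _ (fun z => 'X - z%:P)) //.
rewrite (big_splice_self _ x (fun z => 'X - z%:P) js_uniq) eq_t /=.
by rewrite mulrDl mul_polyC.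
Qed.

Lemma exists_interior_indices (R : realType) (I : finType) (a b : R) (r : nat)
    (x : {ffun I -> R}) :
  cube a b x -> (r < #|` ([fset x i | i : I] `\` [fset a; b])%fset|)%N ->
  exists js : seq I, [/\ size js = r.+1, uniq (map x js) &
    forall z, z \in map x js -> a < z < b].
Proof.
move=> cx; set S := (_ `\` _)%fset => ltS.
have : {subset take r.+1 S <= map x (enum I)}.
  move=> z /mem_take; rewrite !inE => /andP[_ /imfsetP[i _ ->]].
  by rewrite map_f // mem_enum.
move=> /subset_mapP[js _ eq_js].
exists js; rewrite -(size_map x js) -eq_js; split.
- by rewrite size_take_min; apply/minn_idPl.
- by rewrite take_uniq // fset_uniq.
move=> z /mem_take; rewrite !inE negb_or => /andP[/andP[za zb] /imfsetP[i _ zi]].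
by have := cx i; rewrite -zi !lt_def za [b == z]eq_sym zb.
Qed.

(** Moves in both directions: K is the product of the factors of [root_poly x]
    over the indices that are not moved, hence monic of degree #|I| - r - 1. *)
Lemma feasible_shift (R : realType) (I : finType) (a b : R) (r : nat)
    (c : 'I_r -> R) (x : {ffun I -> R}) :
  feasible a b c x -> (r < #|` ([fset x i | i : I] `\` [fset a; b])%fset|)%N ->
  exists K : {poly R}, K`_(#|I| - r.+1) = 1 /\
    exists2 eta, 0 < eta & forall e, `|e| <= eta ->
      exists2 y : {ffun I -> R}, feasible a b c y &
        root_poly y = root_poly x + e *: K.
Proof.
move=> xD /(exists_interior_indices xD.1)[js [sz_js xjs_uniq js_ab]].
have js_uniq : uniq js := map_uniq xjs_uniq.
exists (\prod_(i <- enum [predC js]) ('X - (x i)%:P)); split.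
  have := monic_prod_XsubC (enum [predC js]) xpredT x => /monicP.
  rewrite lead_coefE size_prod_XsubC -cardE -sz_js -(card_uniqP js_uniq).
  by rewrite -(cardC (mem js)) addKn.
have [|eta eta_gt0 etaP] := perturbed_roots xjs_uniq _ js_ab.
  by rewrite size_map sz_js.
exists eta => // e /etaP[t [sz_t t_ab eq_t]]; rewrite size_map in sz_t.
exists (splice x js t); last by rewrite big_enum; exact: root_poly_splice.
by apply: (splice_feasible xD js_uniq _ sz_t t_ab eq_t); rewrite sz_js.
Qed.

(** * Few values inside the segment *)

Theorem theorem1p2 (R : realType) (I : finType) (a b : R)
    (f : {ffun I -> R} -> R)
    (f_sym : perm_invariant a b f) (f_aff : multiaffine a b f)
    (r : nat) (c : 'I_r -> R)
    (D_neq0 : feasible (I := I) a b c !=set0) :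
  exists x : {ffun I -> R},
    [/\ feasible a b c x,
        forall y : {ffun I -> R}, feasible a b c y -> f y <= f x
      & (#|` ([fset x i | i : I] `\` [fset a; b])%fset| <= r)%N].
Proof.
have [lt_ab|le_ba] := ltrP a b; last first.
  have [x0 x0D] := D_neq0.
  have const (x : {ffun I -> R}) i : cube a b x -> x i = a.
    move=> /(_ i) xi; apply/eqP; rewrite eq_le; lra.
  exists x0; split=> // [y [cy _]|].
    rewrite (_ : y = x0) //; apply/ffunP => i.
    by rewrite !const //; case: x0D.
  rewrite (_ : (_ `\` _)%fset = fset0) ?cardfs0 //.
  apply/fsetP => z; rewrite !inE; apply/negbTE/negP => /andP[zab /imfsetP[i _ zi]].
  by move: zab; rewrite zi const ?eqxx //; case: x0D.
have [lam fE] := symmetric_multiaffine_coef_comb lt_ab f_sym f_aff.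
pose k := (#|I| - r.+1)%N.
have [x xD xmax] := exists_feasible_lex_max lam #|I| k D_neq0.
exists x; split=> // [y yD|].
  by rewrite !fE; [have [] := xmax y yD | case: xD | case: yD].
rewrite leqNgt; apply/negP => lt_r.
have [K [K_k [eta eta_gt0 shift]]] := feasible_shift xD lt_r.
have [|y yD Py] := shift eta; first by rewrite gtr0_norm.
have [|z zD Pz] := shift (- eta); first by rewrite normrN gtr0_norm.
have [fy gy] := xmax y yD; have [fz _] := xmax z zD.
rewrite Pz coef_combD coef_combZ in fz.
rewrite Py coef_combD coef_combZ in fy gy.
(* The steps eta and - eta squeeze the first-order term between 0 and 0. *)
have etaK0 : eta * coef_comb lam #|I| K = 0.
  by apply/eqP; rewrite eq_le; lra.
move: gy; rewrite etaK0 addr0 => /(_ erefl).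
by rewrite coefD coefZ K_k mulr1; lra.
Qed.
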